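(* For $\kappa>0$ and $\alpha>0$ define $$h_{\kappa}(\alpha):=\int_0^{\kappa\alpha}\frac{y^{\alpha-1}e^{-y}}{\Gamma(\alpha)}\,dy.$$ Then $$\inf_{\alpha>0}h_{\kappa}(\alpha)=\begin{cases}0, & \kappa\in(0,1),\\[2pt] \frac{1}{2}, & \kappa=1.\end{cases}$$
   Context: $\Gamma$ denotes the Euler Gamma function. Equivalently, $h_\kappa(\alpha)=P\{X_{\alpha,\beta}\le \kappa E[X_{\alpha,\beta}]\}$ (for any scale $\beta>0$; the value does not depend on $\beta$), where $X_{\alpha,\beta}$ is a Gamma random variable with shape parameter $\alpha$ and scale parameter $\beta$, i.e. with density $x^{\alpha-1}e^{-x/\beta}/(\Gamma(\alpha)\beta^{\alpha})$ for $x>0$. *)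

(* Defs.v *)
From HB Require Import structures.
From mathcomp Require Import all_boot all_order all_algebra.
From mathcomp Require Import all_classical all_reals all_analysis.

Set Implicit Arguments.
Unset Strict Implicit.
Unset Printing Implicit Defensive.

Import Order.TTheory GRing.Theory Num.Theory.
Import numFieldNormedType.Exports.

Local Open Scope classical_set_scope.
Local Open Scope ring_scope.

(* The integral is the real-valued one, which is 0 by convention when the
   extended-real integral is infinite; this happens only for a <= 0. *)
Definition Gamma (R : realType) (a : R) : R :=
  \int[lebesgue_measure]_(t in `]0, +oo[) (t `^ (a - 1) * expR (- t)).

Definition h (R : realType) (kappa alpha : R) : R :=
  \int[lebesgue_measure]_(y in `]0, (kappa * alpha)])
    (y `^ (alpha - 1) * expR (- y) / Gamma alpha).

(* Main.v *)
Require Import Defs.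
From HB Require Import structures.
From mathcomp Require Import all_boot all_order all_algebra.
From mathcomp Require Import all_classical all_reals all_analysis.
From mathcomp Require Import measurable_realfun ring lra.

Set Implicit Arguments.
Unset Strict Implicit.
Unset Printing Implicit Defensive.

Import Order.TTheory GRing.Theory Num.Theory.
Import numFieldNormedType.Exports.

Local Open Scope classical_set_scope.
Local Open Scope ring_scope.

(* The lower bound 1/2: with y = a e^s the density y^(a-1) e^(-y) dy becomes
   proportional to exp (-a (e^s - 1 - s)) ds, whose mode is s = 0 and which is
   heavier on the side s < 0, because e^s - e^(-s) >= 2 s for s >= 0.  Hence,
   through the substitution y = a^2 / x, the mass above the mean a is at most
   the mass below it.

   The upper bound 1/2: for a = m + 1 the density is heavier to the right of its
   mode m, by reflection about m, so the mass of ]0, m] is at most 1/2, while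
   the mass of ]m, m + 1] is at most the maximum of the density.  For m = k^2 the
   density stays above 1/e times its maximum on [m, m + k], so this maximum is
   at most e / k, which tends to 0.

   For kappa < 1 the substitution y = kappa z multiplies the density at z by
   kappa^a e^((1 - kappa) z), which gives the Chernoff-type bound
   h kappa a <= (kappa e^(1 - kappa))^a, a geometric sequence in a. *)

(** * Elementary inequalities for the exponential *)

(** The difference of the two sides vanishes at 0, and its derivative equals the nonnegative
    [(expR x - 1) ^+ 2 / expR x]. *)
Lemma expRB_ge2x (R : realType) (s : R) :
  0 <= s -> 2 * s <= expR s - expR (- s).
Proof.
move=> s0.
have dg (x : R) : is_derive x 1 (fun x => expR x - expR (- x) - 2 * x)
    (expR x + expR (- x) - 2).
  apply: is_derive_eq; rewrite /GRing.scale/=; ring.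
rewrite -subr_ge0.
have := @ger0_derive1_le_cc R (fun x => expR x - expR (- x) - 2 * x) 0 s.
move=> /(_ _ _ _ 0 s); rewrite oppr0 expR0 subrr mulr0 subr0; apply => //.
- move=> x _; rewrite derive1E derive_val expRN.
  have e0 := expR_gt0 x.
  have -> : expR x + (expR x)^-1 - 2 = (expR x - 1) ^+ 2 / expR x.
    by field; rewrite gt_eqF.
  by rewrite divr_ge0 ?sqr_ge0 ?ltW.
- apply: continuous_subspaceT => x.
  by apply/differentiable_continuous/derivable1_diffP.
- by rewrite in_itv/= lexx.
- by rewrite in_itv/= lexx s0.
Qed.

(** The difference [g] of the two sides vanishes at 0, and its derivative
    [x * (expR x - expR (- x))] is nonnegative for [x >= 0]. *)
Lemma onemMexpR_le (R : realType) (u : R) : 0 <= u ->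
  (1 - u) * expR u <= (1 + u) * expR (- u).
Proof.
move=> u0.
pose g (x : R) := (1 + x) * expR (- x) - (1 - x) * expR x.
have dg (x : R) : is_derive x 1 g (x * (expR x - expR (- x))).
  apply: is_derive_eq; rewrite /GRing.scale/=; ring.
rewrite -subr_ge0.
have := @ger0_derive1_le_cc R g 0 u.
move=> /(_ _ _ _ 0 u); rewrite /g oppr0 expR0 addr0 subrr; apply => //.
- move=> x /[!in_itv]/= /andP[x0 _]; rewrite derive1E derive_val.
  by rewrite mulr_ge0 ?ltW// subr_gt0 ltr_expR; lra.
- apply: continuous_subspaceT => x.
  by apply/differentiable_continuous/derivable1_diffP.
- by rewrite in_itv/= lexx.
- by rewrite in_itv/= lexx u0.
Qed.

(** * Monotone exhaustion, continuity, and the derivative of an inversion *)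

(** Monotone convergence. This reduces half-open and unbounded intervals to compact ones, where
    substitution and the fundamental theorem of calculus apply. *)
Lemma ge0_integral_bigcup_le d (T : measurableType d) (R : realType)
    (mu : {measure set T -> \bar R}) (F : (set T)^nat) (f : T -> \bar R)
    (M : \bar R) :
  nondecreasing_seq F -> (forall n, measurable (F n)) ->
  measurable_fun [set: T] f -> (forall x, 0 <= f x)%E ->
  (forall n, \int[mu]_(x in F n) f x <= M)%E ->
  (\int[mu]_(x in \bigcup_n F n) f x <= M)%E.
Proof.
move=> ndF mF mf f0 FM.
have mfF n : measurable_fun (F n) f by exact: measurable_funTS.
have := @ge0_nondecreasing_set_cvg_integral _ _ _ F f mu ndF mF mfF
  (fun _ _ _ => f0 _).
by move/cvge_to_le; apply; exact: nearW.
Qed.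

Lemma continuous_expr_expRN (R : realType) (n : nat) :
  continuous (fun x : R => x ^+ n * expR (- x)).
Proof.
move=> x.
apply: (@continuousM _ _ (fun x : R => x ^+ n) (fun x => expR (- x))).
  exact: exprn_continuous.
by apply: continuous_comp; [exact: continuousN|exact: continuous_expR].
Qed.

Lemma measurable_expr_expRN (R : realType) (n : nat) (D : set R) :
  measurable_fun D (fun x : R => x ^+ n * expR (- x)).
Proof.
apply: measurable_funTS; apply: continuous_measurable_fun.
exact: continuous_expr_expRN.
Qed.

Lemma is_derive_divl (R : realType) (c z : R) : z != 0 ->
  is_derive z 1 (fun y => c / y) (- (c / z ^+ 2)).
Proof.
move=> zn0.
have dV := @is_deriveV R id z 1%R 1%R zn0 (is_derive_id _ _).
have -> : (fun y => c / y) = c \*: (fun y => y^-1) by apply/funext.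
by apply: is_derive_eq; rewrite /GRing.scale/=; field.
Qed.

Lemma continuous_derive1_divl (R : realType) (c z : R) : 0 < z ->
  {for z, continuous ((fun y => c / y)^`()%classic)}.
Proof.
move=> z0; have L : (- (c / y ^+ 2)) @[y --> z] --> - (c / z ^+ 2).
  apply: (@cvgN _ _ _ _ _ (fun y => c / y ^+ 2)).
  apply: (@cvgM _ _ _ _ (cst c) (fun y => (y ^+ 2)^-1)).
    exact: cvg_cst.
  apply: (@cvgV _ _ _ _ (fun y => y ^+ 2)); last exact: exprn_continuous.
  by rewrite expf_neq0// gt_eqF.
rewrite /prop_for/continuous_at.
rewrite derive1E; have dz := is_derive_divl c (lt0r_neq0 z0).
rewrite derive_val; apply: (@cvg_trans _ ((- (c / y ^+ 2))%R @[y --> z])).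
  apply: near_eq_cvg; near=> y.
  have y0 : (0 < y)%R by near: y; exact: lt_nbhsr.
  by rewrite derive1E; have dy := is_derive_divl c (lt0r_neq0 y0);
    rewrite derive_val.
exact: L.
Unshelve. all: by end_near. Qed.

(** * Pointwise bounds on [y ^+ m * expR (- y)] around its mode [m] *)

(** With [t = y / m] this is the [m]-th power of [t <= expR (t - 1)]; [m = 0] is treated apart
    because of the division. *)
Lemma expr_expRN_le_mode (R : realType) (m : nat) (y : R) : 0 <= y ->
  y ^+ m * expR (- y) <= m%:R ^+ m * expR (- m%:R).
Proof.
move=> y0; case: m => [|m]; first by rewrite !expr0 !mul1r ler_expR lerN2.
set M : R := m.+1%:R; have M0 : 0 < M by rewrite ltr0n.
have -> : y ^+ m.+1 = M ^+ m.+1 * (y / M) ^+ m.+1.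
  by rewrite -exprMn mulrCA divff ?gt_eqF// mulr1.
rewrite -mulrA ler_wpM2l ?exprn_ge0 ?(ltW M0)//.
have -> : expR (- M) = expR (y / M - 1) ^+ m.+1 * expR (- y).
  by rewrite -expRM_natl -expRD; congr expR; rewrite -/M; field; rewrite gt_eqF.
rewrite ler_wpM2r ?expR_ge0// lerXn2r ?nnegrE ?expR_ge0 ?divr_ge0 ?(ltW M0)//.
by have := expR_ge1Dx (y / M - 1); rewrite addrC subrK.
Qed.

(** Put [y = m * (1 - u)], so that the reflected point is [m * (1 + u)]. The common factor
    [m ^+ m * expR (- m)] cancels and the [m]-th power of [onemMexpR_le] remains. *)
Lemma expr_expRN_reflect_le (R : realType) (m : nat) (y : R) :
  0 <= y <= m%:R -> y ^+ m * expR (- y) <=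
  (m%:R + m%:R - y) ^+ m * expR (- (m%:R + m%:R - y)).
Proof.
case: m => [|m] /andP[y0 ym].
  by rewrite !expr0 !mul1r ler_expR lerN2; lra.
set M : R := m.+1%:R; have M0 : 0 < M by rewrite ltr0n.
have [u u0 yE] : exists2 u, 0 <= u & y = M * (1 - u).
  exists (1 - y / M); first by rewrite subr_ge0 ler_pdivrMr// mul1r.
  by field; rewrite gt_eqF.
have u1 : 0 <= 1 - u by move: y0; rewrite yE pmulr_rge0.
have -> : M + M - y = M * (1 + u) by rewrite yE; ring.
have -> : expR (- y) = expR (- M) * expR u ^+ m.+1.
  by rewrite -expRM_natl -expRD yE -/M; congr expR; ring.
have -> : expR (- (M * (1 + u))) = expR (- M) * expR (- u) ^+ m.+1.
  by rewrite -expRM_natl -expRD -/M; congr expR; ring.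
rewrite yE !exprMn [leLHS]mulrACA [leRHS]mulrACA -!exprMn.
rewrite ler_wpM2l ?mulr_ge0 ?exprn_ge0 ?expR_ge0 ?(ltW M0)//.
rewrite lerXn2r ?nnegrE ?mulr_ge0 ?expR_ge0 ?(addr_ge0 ler01 u0)//.
exact: onemMexpR_le.
Qed.

(** By [M / y <= expR (M / y - 1)], the value at the mode divided by the value at [y] is at most
    [expR ((y - M) ^+ 2 / y)]. The choice [m = k ^ 2] gives [(y - M) ^+ 2 <= k ^ 2 = M <= y], so the
    ratio is at most [expR 1]. *)
Lemma expr_expRN_ge_mode (R : realType) (k : nat) (y : R) : (0 < k)%N ->
  let m := (k ^ 2)%N in m%:R <= y <= m%:R + k%:R ->
  m%:R ^+ m * expR (- m%:R) * expR (- 1) <= y ^+ m * expR (- y).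
Proof.
move=> k0 m /andP[my ymk]; set M : R := m%:R.
have M0 : 0 < M by rewrite ltr0n expn_gt0 k0.
have y0 : 0 < y by exact: lt_le_trans my.
have My : (M / y) ^+ m <= expR (M / y - 1) ^+ m.
  rewrite lerXn2r ?nnegrE ?expR_ge0 ?divr_ge0 ?(ltW y0) ?(ltW M0)//.
  by have := expR_ge1Dx (M / y - 1); rewrite addrC subrK.
have -> : M ^+ m = y ^+ m * (M / y) ^+ m.
  by rewrite -exprMn mulrCA divff ?gt_eqF// mulr1.
rewrite -!mulrA ler_wpM2l ?exprn_ge0 ?(ltW y0)//.
apply: le_trans (ler_wpM2r _ My) _; first by rewrite mulr_ge0 ?expR_ge0.
rewrite -expRM_natl -!expRD ler_expR -/M.
have yM2 : (y - M) ^+ 2 <= y.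
  have Mk : M = k%:R ^+ 2 by rewrite /M natrX.
  rewrite (le_trans _ my)// -/M [leRHS]Mk.
  by apply: lerXn2r; rewrite ?nnegrE ?ler0n ?subr_ge0 ?lerBlDl.
have -> : M * (M / y - 1) + (- M - 1) = (y - M) ^+ 2 / y - 1 - y.
  by field; rewrite gt_eqF.
by rewrite lerBlDr addNr subr_le0 ler_pdivrMr// mul1r.
Qed.

(** * The unnormalised Gamma density of scale 1, pointwise *)

Section kernel.
Context {R : realType}.
Notation mu := (@lebesgue_measure R).
Implicit Types (a c k u v x y : R).

Definition gamma_kernel a x : R := x `^ (a - 1) * expR (- x).

Lemma gamma_kernel_ge0 a x : 0 <= gamma_kernel a x.
Proof. by rewrite mulr_ge0 ?powR_ge0 ?expR_ge0. Qed.

Lemma gamma_kernelE a x : 0 < x ->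
  gamma_kernel a x = expR ((a - 1) * ln x - x).
Proof. by move=> x0; rewrite /gamma_kernel /powR gt_eqF// -expRD. Qed.

Lemma gamma_kernel_nat (n : nat) x : 0 <= x ->
  gamma_kernel n.+1%:R x = x ^+ n * expR (- x).
Proof. by move=> x0; rewrite /gamma_kernel -addn1 natrD addrK powR_mulrn. Qed.

Lemma measurable_gamma_kernel (D : set R) a :
  measurable_fun D (gamma_kernel a).
Proof.
apply: measurable_funTS; apply: measurable_funM => /=.
  exact: measurable_powR.
exact: measurableT_comp.
Qed.

Lemma continuous_gamma_kernel a x : 0 < x ->
  {for x, continuous (gamma_kernel a)}.
Proof.
move=> x0; apply/differentiable_continuous/derivable1_diffP.
apply: derivableM => //; apply: derivable_powR.
by rewrite in_itv/= x0.
Qed.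

Lemma within_continuous_gamma_kernel a x y : 0 < x ->
  {within `[x, y], continuous (gamma_kernel a)}.
Proof.
move=> x0; apply: continuous_in_subspaceT => z; rewrite inE/= in_itv/=.
by move=> /andP[xz _]; apply: continuous_gamma_kernel; exact: lt_le_trans xz.
Qed.

(** The factor [a ^+ 2 / x ^+ 2] is the Jacobian of [x -> a ^+ 2 / x]. With [s = ln (a / x)], taking
    logarithms leaves [2 * a * s <= a * (expR s - expR (- s))], which is [expRB_ge2x]. *)
Lemma gamma_kernel_invert_le a x : 0 < x <= a ->
  gamma_kernel a (a ^+ 2 / x) * (a ^+ 2 / x ^+ 2) <= gamma_kernel a x.
Proof.
move=> /andP[x0 xa]; have a0 : 0 < a by exact: lt_le_trans xa.
pose s := ln (a / x).
have ax0 : 0 < a / x by rewrite divr_gt0.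
have es : expR s = a / x by rewrite lnK// posrE.
have eNs : expR (- s) = x / a by rewrite expRN es invf_div.
have s0 : 0 <= s by rewrite ln_ge0// ler_pdivlMr// mul1r.
have e2s : expR (s + s) = a ^+ 2 / x ^+ 2.
  by rewrite expRD es; field; rewrite gt_eqF.
have lns : ln (a ^+ 2 / x) = ln x + (s + s).
  have -> : a ^+ 2 / x = x * (a / x * (a / x)) by field; rewrite gt_eqF.
  have axx : a / x * (a / x) \in Num.pos by rewrite posrE mulr_gt0.
  by rewrite (lnM _ axx)// lnM.
rewrite !gamma_kernelE ?divr_gt0 ?exprn_gt0// -e2s -expRD ler_expR lns.
have := expRB_ge2x s0; rewrite es eNs -(ler_pM2l a0).
have -> : a * (a / x - x / a) = a ^+ 2 / x - x by field; rewrite !gt_eqF.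
lra.
Qed.

(** * Integrals of the kernel: finiteness, inversion, comparison with constants *)

Local Open Scope ereal_scope.

Lemma ge0_integral_itv0c_le (f : R -> \bar R) c (M : \bar R) : (0 < c)%R ->
  measurable_fun [set: R] f -> (forall x, 0 <= f x) ->
  (forall x, (0 < x < c)%R -> \int[mu]_(y in `[x, c]) f y <= M) ->
  \int[mu]_(y in `]0%R, c]) f y <= M.
Proof.
move=> c0 mf f0 fM.
(* The denominator starts at 2 so that every left endpoint is strictly below [c], as the hypothesis
   on [f] demands. *)
have -> : `]0%R, c]%classic = \bigcup_n `[(c / n.+2%:R)%R, c]%classic.
  apply/seteqP; split => [x|x [n _]] /=; rewrite !in_itv/= => /andP[x0 xc].
    have [n /= nx] : exists n, (c / x <= n%:R)%R.
      by exists (Num.truncn (c / x)).+1; rewrite ltW// truncnS_gt.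
    exists n => //=; rewrite in_itv/= xc andbT.
    rewrite ler_pdivrMr// mulrC -ler_pdivrMr// (le_trans nx)// ler_nat.
    by rewrite ltnW.
  by rewrite xc (lt_le_trans _ x0)// divr_gt0.
apply: ge0_integral_bigcup_le => //.
  apply/nondecreasing_seqP => n; apply/subsetPset; apply: subset_itvr.
  by rewrite bnd_simp ler_pM2l// lef_pV2 ?posrE// ler_nat.
move=> n; apply: fM.
by rewrite divr_gt0//= ltr_pdivrMr// ltr_pMr// ltr1n.
Qed.

Lemma ge0_integral_itvcy_le (f : R -> \bar R) c (M : \bar R) :
  measurable_fun [set: R] f -> (forall x, 0 <= f x) ->
  (forall x, (c < x)%R -> \int[mu]_(y in `[c, x]) f y <= M) ->
  \int[mu]_(y in `[c, +oo[) f y <= M.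
Proof.
move=> mf f0 fM; rewrite itv_bndy_bigcup_BRight.
apply: ge0_integral_bigcup_le => //.
  apply/nondecreasing_seqP => n; apply/subsetPset; apply: subset_itvl.
  by rewrite bnd_simp lerD2l ler_nat.
(* The piece [[c, c + n]] is a single point for [n = 0]; enlarging it to [[c, c + n.+1]] gives the
   strict [c < x]. *)
move=> n; apply: le_trans (fM (c + n.+1%:R)%R _); last by rewrite ltrDl.
apply: ge0_subset_integral => //; first exact: measurable_funTS.
by apply: subset_itvl; rewrite bnd_simp lerD2l ler_nat.
Qed.

Lemma integral_gamma_kernel_lty a c : (0 < a)%R -> (0 < c)%R ->
  \int[mu]_(x in `]0%R, c]) (gamma_kernel a x)%:E < +oo.
Proof.
move=> a0 c0; apply: (@le_lt_trans _ _ (c `^ a / a)%:E); last exact: ltry.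
apply: ge0_integral_itv0c_le => //.
- by apply/measurable_EFinP; exact: measurable_gamma_kernel.
- by move=> x; rewrite lee_fin gamma_kernel_ge0.
move=> x /andP[x0 xc].
have pos z : z \in `[x, c] -> (0 < z)%R.
  by rewrite in_itv/= => /andP[xz _]; exact: lt_le_trans xz.
have cpow b : {within `[x, c], continuous (@powR R ^~ b)}.
  apply: continuous_in_subspaceT => z; rewrite inE/= => /pos z0.
  apply/differentiable_continuous/derivable1_diffP; apply: derivable_powR.
  by rewrite in_itv/= z0.
apply: (@le_trans _ _ (\int[mu]_(y in `[x, c]) (y `^ (a - 1))%:E)).
  apply: ge0_le_integral => //.
  - by move=> z _; rewrite lee_fin gamma_kernel_ge0.
  - by apply/measurable_EFinP; exact: measurable_gamma_kernel.
  - by apply: measurable_funTS; apply/measurable_EFinP; exact: measurable_powR.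
  - move=> z /pos z0; rewrite lee_fin ler_piMr ?powR_ge0// -expR0 ler_expR.
    by rewrite oppr_le0 ltW.
rewrite (@continuous_FTC2 _ _ (fun y => a^-1 * y `^ a)%R)//.
- rewrite -EFinB lee_fin mulrC lerBlDr lerDl.
  by rewrite mulr_ge0 ?powR_ge0// invr_ge0 ltW.
- have := cpow a; move=> /(continuous_within_itvP _ xc)[_ cx cc].
  split.
  + move=> z /subset_itv_oo_cc/pos z0; apply: derivableM => //.
    by apply: derivable_powR; rewrite in_itv/= z0.
  + by apply: cvgM => //; exact: cvg_cst.
  + by apply: cvgM => //; exact: cvg_cst.
- move=> z /subset_itv_oo_cc/pos z0.
  have dz := is_derive1_powR a z0.
  rewrite derive1E deriveM// !derive_val /GRing.scale/= mulr0 addr0.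
  by rewrite mulrA mulVf ?gt_eqF// mul1r.
Qed.


(** Substitute [x = a ^+ 2 / z] on compact pieces and compare pointwise by [gamma_kernel_invert_le].
    Besides the bound 1/2, this yields the finiteness of the tail of [Gamma a]. *)
Lemma integral_gamma_kernel_invert a : (0 < a)%R ->
  \int[mu]_(x in `[a, +oo[) (gamma_kernel a x)%:E <=
  \int[mu]_(x in `]0%R, a]) (gamma_kernel a x)%:E.
Proof.
move=> a0.
have ker0 x : 0 <= (gamma_kernel a x)%:E by rewrite lee_fin gamma_kernel_ge0.
have mker : measurable_fun [set: R] (fun x => (gamma_kernel a x)%:E).
  by apply/measurable_EFinP; exact: measurable_gamma_kernel.
apply: ge0_integral_itvcy_le => // x ax.
have x0 : (0 < x)%R by exact: lt_trans ax.
(* [F] is a decreasing involution fixing [a], so it exchanges [[u, a]] and [[a, x]]. *)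
pose F (z : R) : R := (a ^+ 2 / z)%R.
pose u := F x.
have u0 : (0 < u)%R by rewrite divr_gt0 ?exprn_gt0.
have ua : (u < a)%R by rewrite ltr_pdivrMr// expr2 ltr_pM2l.
have Fu : F u = x by rewrite /u /F; field; rewrite !gt_eqF.
have Fa : F a = a by rewrite /F; field; rewrite gt_eqF.
have dF (z : R) : (0 < z)%R -> is_derive z 1%R F (- (a ^+ 2 / z ^+ 2))%R.
  move=> z0; have zn0 : z != 0%R by rewrite gt_eqF.
  exact: is_derive_divl.
have cF (z : R) : (0 < z)%R -> F^`()%classic y @[y --> z] --> F^`()%classic z.
  exact: continuous_derive1_divl.
have cF0 (z : R) : (0 < z)%R -> F y @[y --> z] --> F z.
  by move=> /dF dFz; apply/differentiable_continuous/derivable1_diffP.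
have := @integration_by_substitution_decreasing R F (gamma_kernel a) u a (ltW ua).
rewrite Fu Fa => -> //.
- apply: (@le_trans _ _ (\int[mu]_(z in `[u, a]) (gamma_kernel a z)%:E)).
    apply: ge0_le_integral => //.
    + move=> z /=; rewrite in_itv/= => /andP[uz _].
      have z0 := lt_le_trans u0 uz.
      rewrite lee_fin !fctE derive1E; have dFz := dF _ z0; rewrite derive_val.
      by rewrite opprK mulr_ge0 ?gamma_kernel_ge0 ?divr_ge0 ?sqr_ge0.
    + apply/measurable_EFinP; apply: subspace_continuous_measurable_fun => //.
      apply: continuous_in_subspaceT => z; rewrite inE/= in_itv/= => /andP[uz _].
      have z0 := lt_le_trans u0 uz.
      apply: continuousM; last by apply: continuousN; exact: cF.
      apply: continuous_comp; first exact: cF0.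
      by apply: continuous_gamma_kernel; rewrite divr_gt0 ?exprn_gt0.
    + exact: measurable_funTS.
    + move=> z /=; rewrite in_itv/= => /andP[uz za].
      have z0 := lt_le_trans u0 uz.
      rewrite lee_fin !fctE derive1E; have dFz := dF _ z0; rewrite derive_val.
      by rewrite opprK gamma_kernel_invert_le// z0.
  apply: ge0_subset_integral => //; first exact: measurable_funTS.
  by apply: subset_itvr; rewrite bnd_simp.
- move=> y z; rewrite !in_itv/= => /andP[uy _] /andP[uz _] yz.
  rewrite ltr_pM2l ?exprn_gt0// ltf_pV2// posrE.
    exact: lt_le_trans uy.
  exact: lt_le_trans uz.
- by move=> z; rewrite in_itv/= => /andP[uz _]; apply: cF; exact: lt_trans uz.
- by apply/cvg_ex; eexists; apply: cvg_at_right_filter; exact: cF.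
- by apply/cvg_ex; eexists; apply: cvg_at_left_filter; exact: cF.
- split.
  + move=> z; rewrite in_itv/= => /andP[uz _].
    by have dFz := dF _ (lt_trans u0 uz).
  + by apply: cvg_at_right_filter; exact: cF0.
  + by apply: cvg_at_left_filter; exact: cF0.
- exact: within_continuous_gamma_kernel.
Qed.

Lemma integral_gamma_kernel_ge a u v c : (0 <= c)%R -> (u <= v)%R ->
  (forall x, u <= x <= v -> c <= gamma_kernel a x)%R ->
  (c * (v - u))%:E <= \int[mu]_(x in `[u, v]) (gamma_kernel a x)%:E.
Proof.
move=> c0 uv cker.
have -> : (c * (v - u))%:E = \int[mu]_(x in `[u, v]) (cst c%:E) x.
  rewrite integral_cst//= lebesgue_measure_itv/= lte_fin EFinM.
  by case: ltgtP uv => // -> _; rewrite subrr.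
apply: ge0_le_integral => //.
by apply/measurable_EFinP; exact: measurable_gamma_kernel.
Qed.

Lemma integral_gamma_kernel_le a u v c : (0 <= c)%R -> (u <= v)%R ->
  (forall x, u < x <= v -> gamma_kernel a x <= c)%R ->
  \int[mu]_(x in `]u, v]) (gamma_kernel a x)%:E <= (c * (v - u))%:E.
Proof.
move=> c0 uv cker.
have -> : (c * (v - u))%:E = \int[mu]_(x in `]u, v]) (cst c%:E) x.
  rewrite integral_cst//= lebesgue_measure_itv/= lte_fin EFinM.
  by case: ltgtP uv => // -> _; rewrite subrr.
apply: ge0_le_integral => //.
- by move=> x _; rewrite lee_fin gamma_kernel_ge0.
- by apply/measurable_EFinP; exact: measurable_gamma_kernel.
Qed.

Lemma integral_gamma_kernelU a (A B : set R) : measurable A -> measurable B ->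
  [disjoint A & B] ->
  \int[mu]_(x in A `|` B) (gamma_kernel a x)%:E =
  \int[mu]_(x in A) (gamma_kernel a x)%:E +
  \int[mu]_(x in B) (gamma_kernel a x)%:E.
Proof.
move=> mA mB AB; apply: ge0_integral_setU => //.
  by apply/measurable_EFinP; exact: measurable_gamma_kernel.
by move=> x _; rewrite lee_fin gamma_kernel_ge0.
Qed.

Lemma le_integral_gamma_kernel a (A B : set R) : measurable A -> measurable B ->
  A `<=` B ->
  \int[mu]_(x in A) (gamma_kernel a x)%:E <=
  \int[mu]_(x in B) (gamma_kernel a x)%:E.
Proof.
move=> mA mB AB; apply: ge0_subset_integral => //.
  by apply/measurable_EFinP; exact: measurable_gamma_kernel.
by move=> x _; rewrite lee_fin gamma_kernel_ge0.
Qed.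

(** The point [c] is counted twice, at no cost since it is a null set; the closed tail is the form
    used by the substitutions. *)
Lemma integral_gamma_kernel0y a c : (0 < c)%R ->
  \int[mu]_(x in `]0%R, +oo[) (gamma_kernel a x)%:E =
  \int[mu]_(x in `]0%R, c]) (gamma_kernel a x)%:E +
  \int[mu]_(x in `[c, +oo[) (gamma_kernel a x)%:E.
Proof.
move=> c0; rewrite (@itv_bndbnd_setU _ _ _ (BRight c)) ?bnd_simp ?(ltW c0)//.
rewrite integral_gamma_kernelU//.
  congr (_ + _); apply: integral_itv_obnd_cbnd.
  by apply/measurable_EFinP; exact: measurable_gamma_kernel.
apply/disj_setPS => y [/=]; rewrite !in_itv/= => /andP[_ yc].
by rewrite ltNge yc.
Qed.

(** * [Gamma] and [h] as integrals of the kernel *)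

(** The extended integral is finite: the mass below [a] is finite, and the inversion bounds the mass
    above [a] by it. *)
Lemma EFin_Gamma a : (0 < a)%R ->
  (Gamma a)%:E = \int[mu]_(x in `]0%R, +oo[) (gamma_kernel a x)%:E.
Proof.
move=> a0; rewrite fineK// ge0_fin_numE; last first.
  by apply: integral_ge0 => x _; rewrite lee_fin gamma_kernel_ge0.
rewrite (integral_gamma_kernel0y _ a0) lte_add_pinfty//.
  exact: integral_gamma_kernel_lty.
apply: le_lt_trans (integral_gamma_kernel_lty a0 a0).
exact: integral_gamma_kernel_invert.
Qed.

Lemma Gamma_gt0 a : (0 < a)%R -> (0 < Gamma a)%R.
Proof.
move=> a0; rewrite -lte_fin EFin_Gamma//.
(* A lower bound for the kernel on [[1, 2]] that holds for either sign of [a - 1]. *)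
pose c : R := (expR (- `|a - 1| * ln 2 - 2))%R.
apply: (@lt_le_trans _ _ (c * (2 - 1))%:E).
  by rewrite lte_fin mulr_gt0 ?expR_gt0//; lra.
apply: (@le_trans _ _ (\int[mu]_(x in `[1%R, 2%R]) (gamma_kernel a x)%:E)).
  apply: integral_gamma_kernel_ge => //; [exact: expR_ge0|lra|].
  move=> x /andP[x1 x2]; rewrite gamma_kernelE ?ler_expR; last lra.
  have l0 : (0 <= ln x)%R by rewrite ln_ge0.
  have l2 : (ln x <= ln 2)%R by rewrite ler_ln ?posrE//; lra.
  apply: lerB => //.
  rewrite (@le_trans _ _ (- `|a - 1| * ln x)%R)//.
    by rewrite !mulNr lerN2 ler_wpM2l.
  by rewrite ler_wpM2r// lerNl -normrN ler_norm.
by apply: le_integral_gamma_kernel => // x/=; rewrite !in_itv/= andbT; lra.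
Qed.

(** Integrability lets [1 / Gamma a] leave the integral, and [Gamma a > 0] cancels it. Claims on [h]
    thereby become comparisons of integrals of one kernel. *)
Lemma EFin_h k a : (0 < k)%R -> (0 < a)%R ->
  (h k a * Gamma a)%:E = \int[mu]_(x in `]0%R, (k * a)%R]) (gamma_kernel a x)%:E.
Proof.
move=> k0 a0; have ka0 : (0 < k * a)%R by rewrite mulr_gt0.
have iker : mu.-integrable `]0%R, (k * a)%R] (EFin \o gamma_kernel a).
  apply/integrableP; split.
    by apply/measurable_EFinP; exact: measurable_gamma_kernel.
  under eq_integral do rewrite /= ger0_norm ?gamma_kernel_ge0//.
  exact: integral_gamma_kernel_lty.
rewrite /h RintegralZr// mulfVK ?gt_eqF ?Gamma_gt0// fineK//.
exact: integrable_fin_num.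
Qed.

(** [Gamma a] is the mass below [a] plus the mass above, and the inversion bounds the second by the
    first. *)
Lemma h1_ge_half a : (0 < a)%R -> (1 / 2 <= h 1 a)%R.
Proof.
move=> a0; have G0 := Gamma_gt0 a0.
have : (Gamma a <= h 1 a * Gamma a + h 1 a * Gamma a)%R.
  rewrite -lee_fin EFinD EFin_h// mul1r EFin_Gamma// (integral_gamma_kernel0y _ a0).
  by rewrite leeD2l// integral_gamma_kernel_invert.
by rewrite -mulrDl -{1}[Gamma a]mul1r ler_pM2r//; lra.
Qed.


(* The two integrands differ at negative points, where [x `^ n%:R] is 1. *)
Lemma integral_gamma_kernel_nat n c d : (0 <= c)%R ->
  \int[mu]_(x in `[c, d]) (gamma_kernel n.+1%:R x)%:E =
  \int[mu]_(x in `[c, d]) (x ^+ n * expR (- x))%:E.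
Proof.
move=> c0; apply: eq_integral => x; rewrite inE/= in_itv/= => /andP[cx _].
by rewrite gamma_kernel_nat// (le_trans c0).
Qed.

Lemma integral_gamma_kernel_itv0c a c :
  \int[mu]_(x in `]0%R, c]) (gamma_kernel a x)%:E =
  \int[mu]_(x in `[0%R, c]) (gamma_kernel a x)%:E.
Proof.
apply: integral_itv_obnd_cbnd.
by apply/measurable_EFinP; exact: measurable_gamma_kernel.
Qed.

(** * The geometric bound at integer shapes *)

(** Substitute [y = k * z]: power and Jacobian give [k ^+ n.+1], and [expR (- (k * z)) <= expR (a *
    (1 - k)) * expR (- z)] for [z <= a]. What remains is at most [Gamma a]. At an integer shape the
    integrand is continuous up to 0, so the substitution works on all of [[0, a]]. *)
Lemma h_le_expn k n : (0 < k)%R -> (k <= 1)%R ->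
  (h k n.+1%:R <= (k * expR (1 - k)) ^+ n.+1)%R.
Proof.
move=> k0 k1; set a : R := n.+1%:R; have a0 : (0 < a)%R by rewrite ltr0n.
rewrite -(ler_pM2r (Gamma_gt0 a0)) -lee_fin EFin_h//.
set K := ((k * _) ^+ _)%R; have K0 : (0 <= K)%R.
  by rewrite exprn_ge0// mulr_ge0 ?expR_ge0// ltW.
pose g x := (x ^+ n * expR (- x))%R.
have g0 x : (0 <= x -> 0 <= g x)%R.
  by move=> x0; rewrite mulr_ge0 ?exprn_ge0 ?expR_ge0.
rewrite integral_gamma_kernel_itv0c integral_gamma_kernel_nat//.
have dk (z : R) : is_derive z 1%R ( *%R k) k.
  by apply: is_derive_eq; rewrite /GRing.scale/= mulr1.
have d1k : ( *%R k)^`()%classic = cst k.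
  by apply/funext => z; rewrite derive1E derive_val.
have ck : continuous ( *%R k) by exact: mulrl_continuous.
have := @integration_by_substitution_increasing R ( *%R k) g 0 a (ltW a0).
rewrite mulr0 => -> //; first last.
- by apply: continuous_subspaceT; exact: continuous_expr_expRN.
- split => //.
  + by move: (ck 0%R) => /cvg_at_right_filter; apply.
  + by move: (ck a) => /cvg_at_left_filter; apply.
- by rewrite d1k; exact: is_cvg_cst.
- by rewrite d1k; exact: is_cvg_cst.
- by rewrite d1k => ? _; exact: cvg_cst.
- by move=> x y _ _ xy; rewrite ltr_pM2l.
apply: (@le_trans _ _ (\int[mu]_(x in `[0%R, a]) (K%:E * (g x)%:E))).
  apply: ge0_le_integral => //.
  - move=> z/=; rewrite in_itv/= => /andP[z0 _].
    rewrite lee_fin !fctE d1k/= mulr_ge0 ?(ltW k0)// g0// mulr_ge0//.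
    exact: ltW.
  - apply/measurable_EFinP; rewrite d1k.
    apply: measurable_funTS; apply: continuous_measurable_fun => z.
    apply: continuousM; last exact: cvg_cst.
    by apply: continuous_comp; [exact: ck|exact: continuous_expr_expRN].
  - apply: emeasurable_funM => //; apply/measurable_EFinP.
    exact: measurable_expr_expRN.
  - move=> z/=; rewrite in_itv/= => /andP[z0 za].
    rewrite lee_fin !fctE d1k/= /K /g.
    have -> : ((k * z) ^+ n * expR (- (k * z)) * k =
        k ^+ n.+1 * z ^+ n * expR (- (k * z)))%R by rewrite exprMn exprS; ring.
    have -> : ((k * expR (1 - k)) ^+ n.+1 * (z ^+ n * expR (- z)) =
        k ^+ n.+1 * z ^+ n * expR (a * (1 - k) - z))%R.
      by rewrite exprMn -expRM_natl expRD; ring.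
    (* The exponents differ by [(a - z) * (1 - k)], nonnegative since [z <= a] and [k <= 1]. *)
    rewrite ler_wpM2l ?mulr_ge0 ?exprn_ge0 ?(ltW k0)// ler_expR.
    by rewrite lerBrDr -subr_ge0 (_ : (_ - _ = (a - z) * (1 - k))%R); [
      rewrite mulr_ge0 ?subr_ge0|ring].
rewrite ge0_integralZl_EFin//; last 2 first.
- by move=> z/=; rewrite in_itv/= => /andP[z0 _]; rewrite lee_fin g0.
- by apply/measurable_EFinP; exact: measurable_expr_expRN.
rewrite EFinM lee_wpmul2l//.
rewrite -integral_gamma_kernel_nat// -integral_gamma_kernel_itv0c EFin_Gamma//.
by apply: le_integral_gamma_kernel => // x/=; rewrite !in_itv/= andbT; case/andP.
Qed.


(** * The upper bound at the mean, along the shapes [k ^ 2 + 1] *)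

(** The reflection [x -> m + m - x] carries [[0, m]] onto [[m, m + m]], with the pointwise
    comparison [expr_expRN_reflect_le]; the mass beyond [m + m] is discarded. *)
Lemma integral_gamma_kernel_reflect m :
  \int[mu]_(x in `]0%R, m%:R]) (gamma_kernel m.+1%:R x)%:E <=
  \int[mu]_(x in `[m%:R, +oo[) (gamma_kernel m.+1%:R x)%:E.
Proof.
set M : R := m%:R; have M0 : (0 <= M)%R by [].
apply: (@le_trans _ _
  (\int[mu]_(x in `[M, (M + M)%R]) (gamma_kernel m.+1%:R x)%:E)); last first.
  by apply: le_integral_gamma_kernel => // x/=; rewrite !in_itv/= andbT; case/andP.
rewrite integral_gamma_kernel_itv0c !integral_gamma_kernel_nat//.
pose g x := (x ^+ m * expR (- x))%R.
pose F x := (M + M - x)%R.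
have FM : F M = M by rewrite /F addrK.
have F0 : F 0%R = (M + M)%R by rewrite /F subr0.
have dF (z : R) : is_derive z 1%R F (-1)%R.
  by apply: is_derive_eq; rewrite add0r mul1r.
have d1F : F^`()%classic = cst (-1)%R.
  by apply/funext => z; rewrite derive1E derive_val.
have cF (z : R) : F y @[y --> z] --> F z.
  by apply/differentiable_continuous/derivable1_diffP.
have := @integration_by_substitution_decreasing R F g 0%R M M0.
rewrite FM F0 => -> //; first last.
- by apply: continuous_subspaceT; exact: continuous_expr_expRN.
- split => //.
  + by move: (cF 0%R) => /cvg_at_right_filter; apply.
  + by move: (cF M) => /cvg_at_left_filter; apply.
- by rewrite d1F; exact: is_cvg_cst.
- by rewrite d1F; exact: is_cvg_cst.
- by rewrite d1F => ? _; exact: cvg_cst.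
- by move=> x y _ _ xy; rewrite /F ltrD2l ltrN2.
apply: ge0_le_integral => //.
- move=> z/=; rewrite in_itv/= => /andP[z0 _].
  by rewrite lee_fin mulr_ge0 ?exprn_ge0 ?expR_ge0.
- by apply/measurable_EFinP; exact: measurable_expr_expRN.
- apply/measurable_EFinP; rewrite d1F.
  apply: measurable_funTS; apply: continuous_measurable_fun => z.
  apply: continuousM; last by apply: continuousN; exact: cvg_cst.
  by apply: continuous_comp; [exact: cF|exact: continuous_expr_expRN].
- move=> z/=; rewrite in_itv/= => zM.
  rewrite lee_fin !fctE d1F/= opprK mulr1.
  exact: expr_expRN_reflect_le.
Qed.


(** The mean [m + 1] exceeds the mode [m] by 1, while the density stays comparable to its maximum
    over a length [k]. The mass between mode and mean is thus at most [expR 1 / k] of the total. *)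
Lemma h1_le (k : nat) : (0 < k)%N ->
  (h 1 (k ^ 2).+1%:R <= 1 / 2 + expR 1 / k%:R :> R)%R.
Proof.
move=> k0; set m := (k ^ 2)%N; set a : R := m.+1%:R.
have a0 : (0 < a)%R by rewrite ltr0n.
have m0 : (0 < m%:R :> R)%R by rewrite ltr0n expn_gt0 k0.
have G0 := Gamma_gt0 a0.
pose M : R := (m%:R ^+ m * expR (- m%:R))%R.
have M0 : (0 <= M)%R by rewrite mulr_ge0 ?exprn_ge0 ?expR_ge0.
have kR0 : (0 < k%:R :> R)%R by rewrite ltr0n.
pose I := \int[mu]_(x in `]0%R, m%:R]) (gamma_kernel a x)%:E.
have Ifin : I \is a fin_num.
  rewrite ge0_fin_numE; first exact: integral_gamma_kernel_lty.
  by apply: integral_ge0 => x _; rewrite lee_fin gamma_kernel_ge0.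
have I2G : (fine I + fine I <= Gamma a)%R.
  rewrite -lee_fin EFinD fineK// EFin_Gamma// (integral_gamma_kernel0y _ m0).
  by rewrite leeD2l// integral_gamma_kernel_reflect.
have hI : (h 1 a * Gamma a <= fine I + M)%R.
  rewrite -lee_fin EFin_h// mul1r EFinD fineK//.
  rewrite (@itv_bndbnd_setU _ _ _ (BRight (m%:R : R)))
    ?bnd_simp ?(ltW m0) ?ler_nat//.
  rewrite integral_gamma_kernelU//; last first.
    apply/disj_setPS => y [/=]; rewrite !in_itv/= => /andP[_ ym].
    by rewrite ltNge ym.
  rewrite leeD2l//.
  (* The interval from mode to mean has length 1. *)
  have -> : M = (M * (a - m%:R))%R.
    by rewrite /a -addn1 natrD addrAC subrr add0r mulr1.
  apply: integral_gamma_kernel_le => //; first by rewrite ler_nat.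
  move=> x /andP[mx _]; have x0 : (0 <= x)%R by rewrite ltW// (lt_trans m0).
  by rewrite gamma_kernel_nat// expr_expRN_le_mode.
have MG : (M * expR (- 1) * k%:R <= Gamma a)%R.
  rewrite -lee_fin EFin_Gamma//.
  have -> : (k%:R : R)%R = (m%:R + k%:R - m%:R)%R by rewrite addrAC subrr add0r.
  apply: le_trans
    (integral_gamma_kernel_ge _ _ (_ : forall x, _ -> _ <= gamma_kernel a x)%R) _.
  - by rewrite mulr_ge0 ?expR_ge0.
  - by rewrite lerDl.
  - move=> x mx; rewrite gamma_kernel_nat; last first.
      by case/andP: mx => mx _; rewrite (le_trans _ mx).
    exact: expr_expRN_ge_mode.
  - apply: le_integral_gamma_kernel => // x/=; rewrite !in_itv/= andbT.
    by move=> /andP[mx _]; exact: lt_le_trans mx.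
(* After multiplication by [Gamma a], the term [1 / 2] absorbs [fine I] by [I2G], and [expR 1 / k]
   absorbs [M] by [MG]. *)
rewrite -(ler_pM2r G0) (le_trans hI)// mulrDl lerD//.
  by rewrite mul1r ler_pdivlMl//; lra.
rewrite mulrAC ler_pdivlMr// mulrC.
move: MG; rewrite expRN -(ler_pM2l (expR_gt0 1)).
have -> // : (expR 1 * (M / expR 1 * k%:R) = k%:R * M)%R.
by field; rewrite gt_eqF ?expR_gt0.
Qed.

End kernel.

(** * The infimum for [kappa < 1] and for [kappa = 1] *)

Theorem mainTheorem4 (R : realType) :
  (forall kappa : R, 0 < kappa -> kappa < 1 ->
     ereal_inf [set (h kappa alpha)%:E | alpha in [set a : R | 0 < a]] = 0%:E)
  /\ ereal_inf [set (h 1 alpha)%:E | alpha in [set a : R | 0 < a]]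
     = (1 / 2 : R)%:E.
Proof.
split=> [k k0 k1|]; apply/eqP; rewrite eq_le; apply/andP; split.
- apply/lee_addgt0Pr => e e0; rewrite add0e.
  set K : R := k * expR (1 - k).
  have K0 : 0 < K by rewrite mulr_gt0 ?expR_gt0.
  (* This is [k < expR (k - 1)], the strict inequality [1 + x < expR x] at the nonzero
     [x = k - 1]. *)
  have K1 : K < 1.
    rewrite /K -[1 - k]opprB expRN ltr_pdivrMr ?expR_gt0// mul1r.
    have := @expR_gt1Dx R (k - 1); rewrite subr_eq0 lt_eqF// => /(_ isT).
    by rewrite [1 + _]addrC subrK.
  have [n Kn] : exists n, K ^+ n.+1 <= e.
    have : K ^+ n @[n --> \oo] --> (0 : R) by apply: cvg_expr; rewrite gtr0_norm.
    move=> /cvgrPdist_lt/(_ e e0)[n _ /(_ n.+1)] /= Kn; exists n.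
    have := Kn (leqnSn n); rewrite sub0r normrN gtr0_norm ?exprn_gt0//.
    exact: ltW.
  apply: ge_ereal_inf; exists (h k n.+1%:R)%:E; first by exists n.+1%:R => //=.
  by rewrite lee_fin (le_trans _ Kn)// h_le_expn// ltW.
- apply: le_ereal_inf_tmp => _ [a /= a0 <-]; rewrite lee_fin.
  have := Gamma_gt0 a0 => G0.
  rewrite -(pmulr_lge0 _ G0) -lee_fin EFin_h//.
  by apply: integral_ge0 => x _; rewrite lee_fin gamma_kernel_ge0.
- apply/lee_addgt0Pr => e e0.
  have [k k0 ke] : exists2 k, (0 < k)%N & expR 1 / k%:R <= e.
    (* The least natural number strictly above [expR 1 / e]; here [e] is the tolerance. *)
    exists (Num.truncn (expR 1 / e)).+1 => //.
    rewrite ler_pdivrMr// mulrC -ler_pdivrMr// ltW// truncnS_gt//.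
  apply: ge_ereal_inf; exists (h 1 (k ^ 2).+1%:R)%:E.
    by exists (k ^ 2).+1%:R => //=.
  by rewrite -EFinD lee_fin (le_trans (h1_le k0))// lerD2l.
- apply: le_ereal_inf_tmp => _ [a /= a0 <-]; rewrite lee_fin.
  exact: h1_ge_half.
Qed.
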